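(* Let $n,m\ge 0$ be integers and let $\lambda,\mu$ be partitions with $\mu\subset\lambda$ and $\ell=\ell(\lambda)\le n$. Then \[ |\mathrm{LHT}_{n,m}(\lambda/\mu)| = m^{|\lambda/\mu|}\det\left(\binom{\lambda_i+n-i}{\mu_j+n-j}\right)_{1\le i,j\le \ell}. \]
   Context: $\mathbb N=\{0,1,2,\dots\}$. A partition $\lambda=(\lambda_1\ge\dots\ge\lambda_k>0)$ has length $\ell(\lambda)=k$, and $\lambda_i=0$ for $i>\ell(\lambda)$. It is identified with its Young diagram $\{(i,j):1\le i\le \ell(\lambda),\,1\le j\le\lambda_i\}$; $\mu\subset\lambda$ means containment of diagrams, $\lambda/\mu$ is the set difference $\lambda\setminus\mu$, and $|\lambda/\mu|$ is its number of cells. The content of a cell is $c(i,j)=j-i$. A tableau of shape $\lambda/\mu$ is a map $\lambda/\mu\to\mathbb N$. An $n$-lecture hall tableau of shape $\lambda/\mu$ is a tableau $L$ of shape $\lambda/\mu$ such that \[ \frac{L(i,j)}{n+c(i,j)}\ge\frac{L(i,j+1)}{n+c(i,j+1)},\qquad \frac{L(i,j)}{n+c(i,j)}>\frac{L(i+1,j)}{n+c(i+1,j)} \] whenever the cells involved lie in $\lambda/\mu$. $\mathrm{LHT}_{n,m}(\lambda/\mu)$ is the set of such $L$ with $\lfloor L(i,j)/(n-i+j)\rfloor<m$ for every $(i,j)\in\lambda/\mu$. Conventions: $0^0=1$, an empty determinant is $1$. *)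

(* Defs.v *)
From mathcomp Require Import all_boot all_order all_algebra.
From mathcomp Require Import finmap.
From mathcomp Require Import classical_sets cardinality.

Set Implicit Arguments.
Unset Strict Implicit.
Unset Printing Implicit Defensive.

Import Order.TTheory GRing.Theory Num.Theory.
Local Open Scope ring_scope.

                                                                         
                                            
Definition is_partition (la : seq nat) : bool :=
  sorted geq la && (0%N \notin la).

                                            
Definition part (la : seq nat) (i : nat) : nat := nth 0%N la i.-1.

Definition diagram (la : seq nat) : {fset nat * nat} :=
  [fset c in [seq (i, j) | i <- iota 1 (size la), j <- iota 1 (part la i)]]%fset.

Definition skew_shape (la mu : seq nat) : {fset nat * nat} :=
  (diagram la `\` diagram mu)%fset.

Definition content (c : nat * nat) : int := c.2%:Z - c.1%:Z.

Notation tableau S := {ffun S -> nat}.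

(* On the cells of a diagram with at most n rows, n + c(i,j) is positive. *)
Definition lh_ratio (n : nat) (S : {fset nat * nat}) (L : tableau S) (c : S)
    : rat :=
  (L c)%:R / (n%:Z + content (val c))%:~R.

Definition is_lecture_hall (n : nat) (S : {fset nat * nat}) (L : tableau S)
    : Prop :=
  (forall a b : S, val b = ((val a).1, (val a).2.+1) ->
     lh_ratio n L b <= lh_ratio n L a)
  /\
  (forall a b : S, val b = ((val a).1.+1, (val a).2) ->
     lh_ratio n L b < lh_ratio n L a).

Definition LHT (n m : nat) (la mu : seq nat)
    : set (tableau (skew_shape la mu)) :=
  [set L | is_lecture_hall n L /\
           forall c : skew_shape la mu, Num.floor (lh_ratio n L c) < m%:Z]%classic.

Arguments LHT : clear implicits.

(* Main.v *)
Require Import Defs.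
From mathcomp Require Import all_boot all_order all_algebra.
From mathcomp Require Import perm finmap zify ring.
From mathcomp Require Import classical_sets cardinality.

(** The proof replaces each row of the shape by an interval of integers: a cell
(i, j) gets the position p = n + j - i - 1, so that row i fills the positions
from mu_i + n - i up to, but excluding, la_i + n - i (the beads of mu and la).
The right neighbour of (i, p) is (i, p + 1), the cell below it is
(i + 1, p - 1), and the denominator of the lecture hall ratio is p + 1.

Write an entry as x = q (p + 1) + r with r <= p.  Ratios of adjacent cells
compare like the pairs (q, r) in lexicographic order ([level_le]).  For a bound
M on the positions, the reversed rank t = (m - 1 - q) M + (M - 1 - r) therefore
turns the lecture hall tableaux bounded by m into fillings with 0 <= t < m M
that increase weakly along rows and strictly down columns, subject to one
local condition on (t, p) that expresses r <= p ([card_LHT]).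

Fillings with a local condition are counted by a determinant ([card_tableaux]),
for an arbitrary condition.  One allows the largest value s only in the rows
from r on.  Row r either avoids s, and r moves on to r + 1, or its last cell
contains s and can be removed.  The determinant obeys the same recursion
because it is linear in row r; when removal is illegal, the corresponding
determinant has two equal rows or a large block of zeros, and vanishes.

The entries of the determinant are coefficients of polynomials describing a
single row.  For the lecture hall condition these polynomials are products of
powers of q + X and q + 1 + X ([path_poly_level]), and after all m M levels
the polynomial of a is (m + X)^a, whose coefficients are m^(a-b) binom(a, b).
Every term of the determinant then carries the same power of m
([det_homogeneous]). *)

Set Implicit Arguments.
Unset Strict Implicit.
Unset Printing Implicit Defensive.
Import Order.TTheory GRing.Theory Num.Theory.
Local Open Scope ring_scope.

(** * The determinant of a family of rows *)

Definition decreasing_upto (l : nat) (a : nat -> nat) : Prop :=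
  forall i, (i.+1 < l)%N -> (a i.+1 < a i)%N.

Lemma decreasing_upto_lt l a i j :
  decreasing_upto l a -> (i < j < l)%N -> (a j < a i)%N.
Proof.
move=> da /andP[+ jl]; elim: j jl => [//|j IHj] jl.
rewrite ltnS leq_eqVlt => /orP[/eqP ->|ij]; first exact: da.
by apply: (ltn_trans (da _ jl)); apply: IHj => //; apply: ltnW.
Qed.

(** The coefficient of ['X^b] counts the rows filling the positions b, ..., a - 1
with weakly increasing values below [s], the value [t] at position [p] being
allowed when [ok t p]: the last entry either is less than the largest value,
or equals it and can be removed. *)
Fixpoint path_poly (ok : nat -> nat -> bool) (s a : nat) : {poly int} :=
  if s is t.+1 then
    (fix steps a := path_poly ok t a +
       if a is c.+1 then (ok t c)%:R * steps c else 0) a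
  else 'X^a.

Lemma path_polyS0 ok s : path_poly ok s.+1 0 = path_poly ok s 0.
Proof. by rewrite /= addr0. Qed.

Lemma path_polySS ok s a : path_poly ok s.+1 a.+1 =
  path_poly ok s a.+1 + (ok s a)%:R * path_poly ok s.+1 a.
Proof. by []. Qed.

Lemma coef_path_poly_lt ok s a b : (a < b)%N -> (path_poly ok s a)`_b = 0.
Proof.
elim: s a => [|s IHs] a ab; first by rewrite coefXn gtn_eqF.
elim: a ab => [|a IHa] ab; first by rewrite path_polyS0 IHs.
rewrite path_polySS coefD IHs // add0r.
by case: (ok s a); rewrite ?mul0r ?coef0 // mul1r IHa // ltnW.
Qed.

(** No permutation can avoid the block: it would send the indices from [r] on
injectively into those after [r]. *)
Lemma det_zero_block (l : nat) (A : 'M[int]_l) (r : 'I_l) :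
  (forall i j : 'I_l, (r <= i)%N -> (j <= r)%N -> A i j = 0) -> \det A = 0.
Proof.
move=> A0; rewrite /determinant big1 // => s _.
have [i ri sir] : exists2 i : 'I_l, (r <= i)%N & (s i <= r)%N.
  apply/exists_inP; apply: contraT => /exists_inPn sr.
  suff /subset_leq_card : s @: [set i : 'I_l | (r <= i)%N]
      \subset [set i : 'I_l | (r <= i)%N] :\ r.
    rewrite card_imset; last exact: perm_inj.
    by rewrite (cardsD1 r [set i : 'I_l | (r <= i)%N]) inE leqnn ltnn.
  apply/fintype.subsetP => _ /imsetP[i + ->]; rewrite !inE => ri.
  have := sr i ri; rewrite -ltnNge => rsi.
  by rewrite -val_eqE /= gtn_eqF // ltnW.
by rewrite (bigD1 i) //= A0 // mul0r mulr0.
Qed.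

(** A strict bound on the entries of row [i]: the value [s] itself is available
only from row [r] on. *)
Definition flag (s r i : nat) : nat := (s + (r <= i))%N.

Definition path_mx l ok (f a b : nat -> nat) : 'M[int]_l :=
  \matrix_(i, j) (path_poly ok (f i) (a i))`_(b j).

Definition lower (r : nat) (a : nat -> nat) : nat -> nat :=
  [eta a with r |-> (a r).-1].

(** Row ends of a shape decrease strictly, so shortening row [r] requires the end
of the next row to be less than a_r - 1. *)
Definition removable l (r : nat) (a b : nat -> nat) : bool :=
  (b r < a r)%N && ((r.+1 < l)%N ==> (a r.+1 < (a r).-1)%N).

(** Row [r] of the matrix satisfies the recursion of [path_poly], and the
determinant is linear in it.  If the last cell of row [r] is not removable, then
the lowered determinant vanishes: either row [r] was empty, and lowering it
creates a block of zeros, or the lowered row coincides with the next one. *)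
Lemma det_path_mx_step l ok s r a b : (r < l)%N ->
  decreasing_upto l a -> decreasing_upto l b ->
  \det (path_mx l ok (flag s r) a b) =
    \det (path_mx l ok (flag s r.+1) a b) +
    (removable l r a b && ok s (a r).-1)%:R *
      \det (path_mx l ok (flag s r) (lower r a) b).
Proof.
move=> rl da db.
pose i0 := Ordinal rl.
have lowr : lower r a r = (a r).-1 by rewrite /lower /= eqxx.
have low i : (i != r)%N -> lower r a i = a i by rewrite /lower /= => /negPf->.
have flE i : (i != r)%N -> flag s r.+1 i = flag s r i.
  by rewrite /flag; lia.
have flr : flag s r.+1 r = s by rewrite /flag ltnn addn0.
have flr' : flag s r r = s.+1 by rewrite /flag leqnn addn1.
have step : \det (path_mx l ok (flag s r) a b) =
    1 * \det (path_mx l ok (flag s r.+1) a b) +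
    ((0 < a r) && ok s (a r).-1)%N%:R *
      \det (path_mx l ok (flag s r) (lower r a) b).
  apply: (determinant_multilinear (i0 := i0)).
  - apply/rowP => j; rewrite !mxE [nat_of_ord i0]/= flr flr' lowr mul1r.
    case: (a r) => [|c]; first by rewrite path_polyS0 mul0r addr0.
    by rewrite path_polySS coefD; case: (ok s c); rewrite ?(mul1r, mul0r, coef0).
  - by apply/matrixP => i j; rewrite !mxE flE //= eq_sym neq_bump.
  - by apply/matrixP => i j; rewrite !mxE low //= eq_sym neq_bump.
rewrite step mul1r; congr (_ + _).
have [rem|nrem] := boolP (removable _ _ _ _).
  by rewrite (leq_ltn_trans _ (proj1 (andP rem))).
case: posnP => [|ar0] /=; first by rewrite mul0r.
rewrite mul0r.
suff -> : \det (path_mx l ok (flag s r) (lower r a) b) = 0 by rewrite mulr0.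
have [abr|bar] := leqP (a r) (b r).
  apply: (@det_zero_block _ _ i0) => i j /= ri jr; rewrite mxE.
  apply: coef_path_poly_lt.
  have bj : (b r <= b j)%N.
    move: jr; rewrite leq_eqVlt => /orP[/eqP->//|jr].
    by apply/ltnW/(decreasing_upto_lt db); rewrite jr.
  apply: leq_trans bj; apply: leq_trans abr.
  move: ri; rewrite leq_eqVlt => /orP[/eqP<-|ri].
    by rewrite lowr prednK.
  by rewrite low ?gtn_eqF // (decreasing_upto_lt da) // ri ltn_ord.
move: nrem; rewrite /removable bar /= negb_imply -leqNgt => /andP[r1l ar1].
apply: (@determinant_alternate _ _ _ i0 (Ordinal r1l)).
  by rewrite -val_eqE /= ltn_eqF.
move=> j; rewrite !mxE [nat_of_ord i0]/= [nat_of_ord (Ordinal _)]/=.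
rewrite flr' lowr low ?gtn_eqF //.
have -> : flag s r r.+1 = s.+1 by rewrite /flag leqnSn addn1.
by have -> : (a r).-1 = a r.+1 by have := da r r1l; lia.
Qed.

(** * Fillings of shifted skew shapes *)

Definition skew_cell (a b : nat -> nat) (i p : nat) : bool := (b i <= p < a i)%N.

(** Rows are compared by position, so the cell below (i, p) is (i + 1, p - 1).
Values off the shape are set to [ord0] to have one filling per tableau. *)
Definition tableaux l M K (ok : nat -> nat -> bool) (a b f : nat -> nat) :
    {set {ffun 'I_l * 'I_M -> 'I_K.+1}} :=
  [set T : {ffun 'I_l * 'I_M -> 'I_K.+1} |
    [forall c : 'I_l * 'I_M, if skew_cell a b c.1 c.2
               then (T c < f c.1)%N && ok (T c) c.2 else T c == ord0] &&
    [forall c : 'I_l * 'I_M, forall d : 'I_l * 'I_M,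
      skew_cell a b c.1 c.2 && skew_cell a b d.1 d.2 ==>
      (((d.1 == c.1 :> nat) && (d.2 == c.2.+1 :> nat)) ==> (T c <= T d)%N) &&
      (((d.1 == c.1.+1 :> nat) && (c.2 == d.2.+1 :> nat)) ==> (T c < T d)%N)]].

Section Tableaux.
Variables (l M K : nat) (ok : nat -> nat -> bool).
Implicit Types (a b f : nat -> nat) (T : {ffun 'I_l * 'I_M -> 'I_K.+1}).
Local Notation skew a b c := (skew_cell a b (fst c) (snd c)).

Lemma tableauxP a b f T : reflect
  [/\ forall c : 'I_l * 'I_M, skew a b c -> (T c < f c.1)%N /\ ok (T c) c.2,
      forall c : 'I_l * 'I_M, ~~ skew a b c -> T c = ord0,
      forall c d : 'I_l * 'I_M, skew a b c -> skew a b d -> d.1 = c.1 :> nat ->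
        d.2 = c.2.+1 :> nat -> (T c <= T d)%N
    & forall c d : 'I_l * 'I_M, skew a b c -> skew a b d -> d.1 = c.1.+1 :> nat ->
        c.2 = d.2.+1 :> nat -> (T c < T d)%N]
  (T \in tableaux l M K ok a b f).
Proof.
rewrite inE; apply: (iffP andP) => [[/forallP v /forallP m]|[v1 v0 r k]].
  split=> [c cs|c /negPf cs|c d cs ds e1 e2|c d cs ds e1 e2].
  - by have := v c; rewrite cs => /andP.
  - by have := v c; rewrite cs => /eqP.
  - by have /forallP/(_ d) := m c; rewrite cs ds e1 e2 !eqxx /= => /andP[].
  - by have /forallP/(_ d) := m c; rewrite cs ds e1 e2 !eqxx /= => /andP[].
split; apply/forallP => c; first case: ifPn => [/v1[-> ->]//|/v0 ->//].
apply/forallP => d; apply/implyP => /andP[cs ds]; apply/andP; split.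
  by apply/implyP => /andP[/eqP e1 /eqP e2]; apply: r.
by apply/implyP => /andP[/eqP e1 /eqP e2]; apply: k.
Qed.

Lemma cell_inj (c d : 'I_l * 'I_M) :
  c.1 = d.1 :> nat -> c.2 = d.2 :> nat -> c = d.
Proof.
by case: c d => [c1 c2] [d1 d2] /= e1 e2; congr (_, _); apply: val_inj.
Qed.

Lemma tableaux_row_le a b f T (c d : 'I_l * 'I_M) :
  T \in tableaux l M K ok a b f -> skew a b c -> skew a b d -> d.1 = c.1 :> nat ->
  (c.2 <= d.2)%N -> (T c <= T d)%N.
Proof.
case/tableauxP => _ _ row _ cs.
move: d => [i [p pM]] /=; elim: p pM => [|p IHp] pM /= ds e1.
  rewrite leqn0 => /eqP e2; rewrite (_ : c = (i, Ordinal pM)) //; exact: cell_inj.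
rewrite leq_eqVlt => /orP[/eqP e2|].
  rewrite (_ : c = (i, Ordinal pM)) //; exact: cell_inj.
rewrite ltnS => cp.
have pM' : (p < M)%N by apply: ltnW.
have ds' : skew a b (i, Ordinal pM').
  move: cs ds; rewrite /skew_cell /= -e1 => /andP[bc _] /andP[_ pa].
  by rewrite (leq_trans bc cp) ltnW.
apply: leq_trans (IHp pM' ds' e1 cp) _; exact: row.
Qed.

Lemma tableaux_flagS a b s r T :
  (T \in tableaux l M K ok a b (flag s r.+1)) =
  (T \in tableaux l M K ok a b (flag s r)) &&
  [forall c : 'I_l * 'I_M, (skew a b c && (c.1 == r :> nat)) ==> (T c < s)%N].
Proof.
apply/tableauxP/andP => [[v v0 row col]|[/tableauxP[v v0 row col] /forallP lt]].
  split; last first.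
    apply/forallP => c; apply/implyP => /andP[cs /eqP cr].
    by have [] := v c cs; rewrite cr /flag ltnn addn0.
  apply/tableauxP; split=> // c cs; have [Tc okc] := v c cs; split=> //.
  by apply: leq_trans Tc _; rewrite /flag; lia.
split=> // c cs; have [Tc okc] := v c cs; split=> //.
have := lt c; rewrite cs /= => /implyP; move: Tc; rewrite /flag.
by case: eqP => [->|]; [rewrite ltnn addn0 => _; apply|lia].
Qed.

(** In row [r] the value [s] occurs iff the last cell contains it.  If that cell
exists but is not removable, the entry below it would have to exceed [s], so [s]
does not occur.  If it is removable, erasing an [s] there is a bijection onto the
fillings of the smaller shape, provided that [ok] allows the [s]; it is
reversible since rows above [r] do not use [s]. *)
Lemma card_tableaux_step s r a b : (r < l)%N -> (s <= K)%N ->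
  decreasing_upto l a -> decreasing_upto l b ->
  (forall i, (i < l)%N -> (b i <= a i <= M)%N) ->
  #|tableaux l M K ok a b (flag s r)| =
    (#|tableaux l M K ok a b (flag s r.+1)| +
    (removable l r a b && ok s (a r).-1) *
      #|tableaux l M K ok (lower r a) b (flag s r)|)%N.
Proof.
move=> rl sK da db baM.
have [/andP[bar adj]|nrem] := boolP (removable _ _ _ _); last first.
  rewrite mul0n addn0; apply: eq_card => T; rewrite tableaux_flagS.
  have [tT|//] := boolP (T \in _); symmetry; apply/forallP => c.
  apply/implyP => /andP[cs /eqP cr].
  have bar : (b r < a r)%N by move: cs; rewrite /skew_cell cr; lia.
  move: nrem; rewrite /removable bar /= negb_imply -leqNgt => /andP[r1l ar1].
  have [_ arM] := andP (baM r rl).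
  have lM : ((a r).-1 < M)%N by lia.
  have arr : (a r).-1 = a r.+1 by have := da r r1l; lia.
  have br1 := db r r1l.
  have uM : ((a r).-2 < M)%N by lia.
  pose e := (Ordinal rl, Ordinal lM) : 'I_l * 'I_M.
  (* The cell below the last cell [e] of row [r]: its entry exceeds that of [e],
  yet is at most [s]. *)
  pose d := (Ordinal r1l, Ordinal uM) : 'I_l * 'I_M.
  have es : skew a b e by rewrite /skew_cell /=; lia.
  have ds : skew a b d by rewrite /skew_cell /=; lia.
  apply: (@leq_ltn_trans (T e)).
    apply: (tableaux_row_le tT) => //.
    by move: cs; rewrite /skew_cell cr /=; lia.
  case/tableauxP: tT => v _ _ col.
  have [+ _] := v d ds; rewrite /flag /= leqnSn addn1 ltnS; apply: leq_trans.
  by apply: col => //=; lia.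
have [_ arM] := andP (baM r rl).
have lM : ((a r).-1 < M)%N by lia.
pose e := (Ordinal rl, Ordinal lM) : 'I_l * 'I_M.
have es : skew a b e by rewrite /skew_cell /=; lia.
have eP (c : 'I_l * 'I_M) :
    (c == e) = (c.1 == r :> nat) && (c.2 == (a r).-1 :> nat).
  by rewrite -pair_eqE.
have skewE (c : 'I_l * 'I_M) : skew a b c = (c == e) || skew (lower r a) b c.
  rewrite eP /skew_cell /lower /=; case: eqP => [->|_] //=; lia.
have skewNe : ~~ skew (lower r a) b e by rewrite /skew_cell /lower /= eqxx; lia.
pose B := [set T : {ffun 'I_l * 'I_M -> 'I_K.+1} | T e == s :> nat].
have BE T : (T \in B) = (T e == s :> nat) by rewrite inE.
rewrite -(cardsID B) addnC; congr (_ + _)%N.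
  apply: eq_card => T; rewrite tableaux_flagS finset.in_setD BE andbC.
  have [tT|//] := boolP (T \in tableaux l M K ok a b (flag s r)); rewrite //=.
  case/tableauxP: (tT) => v _ _ _.
  apply/idP/forallP => [nTe c|/(_ e)]; last by rewrite es eqxx /= => /ltn_eqF->.
  apply/implyP => /andP[cs /eqP cr].
  apply: (@leq_ltn_trans (T e)).
    apply: (tableaux_row_le tT) => //.
    by move: cs; rewrite /skew_cell cr /=; lia.
  by have [+ _] := v e es; rewrite /flag leqnn addn1 ltnS ltn_neqAle nTe.
have sE : (inord s : 'I_K.+1) = s :> nat by rewrite inordK.
case: (boolP (ok s _)) => oks; last first.
  rewrite mul0n; apply: eq_card0 => T; rewrite finset.in_setI BE.
  apply/negP => /andP[tT /eqP Te]; case/tableauxP: tT => /(_ e es)[_ +] _ _ _.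
  by rewrite Te (negPf oks).
rewrite mul1n.
(* Adding the last cell with value [s], and erasing it again. *)
pose put (x : 'I_K.+1) T := [ffun c => if c == e then x else T c].
have putK T : T \in tableaux l M K ok (lower r a) b (flag s r) ->
    put ord0 (put (inord s) T) = T.
  case/tableauxP => _ v0 _ _; apply/ffunP => c; rewrite !ffunE.
  by case: eqP => // ->; rewrite v0.
rewrite -(card_in_imset (f := put (inord s))
  (D := tableaux l M K ok (lower r a) b (flag s r))); last first.
  by move=> T1 T2 t1 t2 e12; rewrite -(putK _ t1) e12 putK.
apply: eq_card => T; rewrite finset.in_setI BE; apply/andP/imsetP; last first.
  case=> U tU ->; split; last by rewrite ffunE eqxx sE.
  have skewNE (c : 'I_l * 'I_M) : skew a b c -> c != e -> skew (lower r a) b c.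
    by rewrite skewE => /orP[->//|].
  case/tableauxP: tU => v v0 row col.
  apply/tableauxP; split=> [c cs|c|c d cs ds e1 e2|c d cs ds e1 e2];
    rewrite !ffunE.
  - case: eqP => [->|/eqP/(skewNE _ cs)/v//].
    by rewrite sE /flag leqnn addn1.
  - by rewrite skewE negb_or => /andP[/negPf -> /v0].
  - case: (c =P e) => [ce|/eqP/(skewNE _ cs) cs'].
      move: ds e2; rewrite /skew_cell e1 ce /=; lia.
    case: (d =P e) => [de|/eqP/(skewNE _ ds) ds']; last exact: row.
    by have [+ _] := v c cs'; rewrite sE -e1 de /flag leqnn addn1.
  - case: (c =P e) => [ce|/eqP/(skewNE _ cs) cs'].
      have := ltn_ord d.1; move: adj ds e2; rewrite /skew_cell e1 ce /=; lia.
    case: (d =P e) => [de|/eqP/(skewNE _ ds) ds']; last exact: col.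
    have [+ _] := v c cs'; rewrite sE; move: e1; rewrite de /flag /= => ->.
    by rewrite ltnn addn0.
case=> tT /eqP Te; exists (put ord0 T); last first.
  apply/ffunP => c; rewrite !ffunE; case: eqP => // ->.
  by apply: val_inj; rewrite /= sE.
have skewW (c : 'I_l * 'I_M) :
    skew (lower r a) b c -> (c == e) = false /\ skew a b c.
  move=> cs; rewrite skewE cs orbT; split=> //.
  by apply/negP => /eqP ce; move: skewNe; rewrite -ce cs.
case/tableauxP: tT => v v0 row col.
apply/tableauxP; split=> [c /skewW[ce cs]|c cs|c d /skewW[ce cs] /skewW[de ds]
  |c d /skewW[ce cs] /skewW[de ds]]; rewrite !ffunE.
- by rewrite ce; apply: v.
- by case: ifPn => // ce; apply: v0; rewrite skewE negb_or ce.
- by rewrite ce de; apply: row.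
- by rewrite ce de; apply: col.
Qed.

End Tableaux.

(** * Counting fillings by a determinant *)

Lemma eq_tableaux l M K ok a b f g : (forall i, (i < l)%N -> f i = g i) ->
  tableaux l M K ok a b f = tableaux l M K ok a b g.
Proof.
move=> fg; apply/setP => T; rewrite !inE; congr (_ && _).
by apply: eq_forallb => c; rewrite fg.
Qed.

Lemma eq_path_mx l ok a b f g : (forall i, (i < l)%N -> f i = g i) ->
  path_mx l ok f a b = path_mx l ok g a b.
Proof. by move=> fg; apply/matrixP => i j; rewrite !mxE fg. Qed.

(** With no value available only the empty shape has a filling, and the matrix
of the Kronecker deltas of a_i and b_j is triangular. *)
Lemma card_tableaux0 l M K ok a b :
  decreasing_upto l b -> (forall i, (i < l)%N -> (b i <= a i <= M)%N) ->
  #|tableaux l M K ok a b (fun=> 0)|%:Z = \det (path_mx l ok (fun=> 0) a b).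
Proof.
move=> db baM; rewrite det_trig; last first.
  apply/is_trig_mxP => i j ij; rewrite mxE coefXn.
  have /andP[bai _] := baM i (ltn_ord i).
  by rewrite ltn_eqF // (leq_trans _ bai) // (decreasing_upto_lt db) // ij /=.
under eq_bigr do rewrite mxE coefXn.
have [/forallP ab|/forallPn[i bi]] := boolP [forall i : 'I_l, b i == a i].
  rewrite big1 => [|i _]; last by rewrite ab.
  have -> : tableaux l M K ok a b (fun=> 0) = [set [ffun=> ord0]]%SET.
    have nskew (c : 'I_l * 'I_M) : skew_cell a b c.1 c.2 = false.
      by rewrite /skew_cell (eqP (ab c.1)); lia.
    apply/setP => T; rewrite !inE; apply/andP/eqP => [[/forallP v0 _]|->].
      by apply/ffunP => c; have := v0 c; rewrite nskew ffunE => /eqP.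
    by split; apply/forallP => c; rewrite ?nskew ?ffunE //; apply/forallP.
  by rewrite cards1.
rewrite (bigD1 i) //= (negPf bi) mul0r.
rewrite (_ : tableaux _ _ _ _ _ _ _ = finset.set0) ?cards0 //.
apply/setP => T; rewrite finset.in_set0; apply/negP => /tableauxP[v _ _ _].
have /andP[bai aM] := baM i (ltn_ord i).
have bM : (b i < M)%N by rewrite (leq_trans _ aM) // ltn_neqAle bi.
have sk : skew_cell a b i (b i) by rewrite /skew_cell leqnn ltn_neqAle bi.
by have [] := v (i, Ordinal bM) sk.
Qed.

Lemma decreasing_upto_lower l r a b : decreasing_upto l a ->
  removable l r a b -> decreasing_upto l (lower r a).
Proof.
move=> da /andP[_ adj] i il; rewrite /lower /=; move: adj il (da i il).
by case: (i =P r) => [<-|_]; [rewrite gtn_eqF|case: (_ =P r) => [<-|_]]; lia.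
Qed.

(** Both sides satisfy the same recursion: [card_tableaux_step] and
[det_path_mx_step].  The induction goes over the largest value, then over the
rows from the last one up, then over the length of the current row. *)
Lemma card_tableaux l M K ok a b s : (s <= K)%N ->
  decreasing_upto l a -> decreasing_upto l b ->
  (forall i, (i < l)%N -> (b i <= a i <= M)%N) ->
  #|tableaux l M K ok a b (fun=> s)|%:Z = \det (path_mx l ok (fun=> s) a b).
Proof.
move=> sK + db; elim: s sK a => [|s IHs] sK a da baM.
  exact: card_tableaux0.
(* Letting [r] run from 0 to [l] withdraws the value [s] from all rows. *)
have flag_l i : (i < l)%N -> flag s l i = s by rewrite /flag; lia.
have flag_0 i : (i < l)%N -> s.+1 = flag s 0 i by rewrite /flag addn1.
rewrite (eq_tableaux _ _ _ _ _ flag_0) (eq_path_mx _ _ _ flag_0).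
suff main k r : (k + r = l)%N -> #|tableaux l M K ok a b (flag s r)|%:Z =
    \det (path_mx l ok (flag s r) a b) by apply: (main l 0%N); rewrite addn0.
elim: k r a da baM => [|k IHk] r a da baM.
  rewrite add0n => ->.
  by rewrite (eq_tableaux _ _ _ _ _ flag_l) (eq_path_mx _ _ _ flag_l) IHs // ltnW.
move=> krl; have rl : (r < l)%N by lia.
move: {2}(a r) (leqnn (a r)) => N; elim: N a da baM => [|N IHN] a da baM arN;
  rewrite card_tableaux_step ?(ltnW sK) // det_path_mx_step // PoszD PoszM
    IHk ?addnS //; congr (_ + _); case: (boolP (removable l r a b)) => rem;
  rewrite ?mul0r //.
  by move: rem; rewrite /removable; lia.
have /andP[bar _] := rem.
congr (_ * _); first by rewrite natz.
apply: IHN; first exact: decreasing_upto_lower rem.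
- move=> i il; have := baM i il; rewrite /lower /=; case: eqP => // ->; lia.
- by rewrite /lower /= eqxx; lia.
Qed.

(** * The row polynomials of the lecture hall condition *)

(** In [s = (m - 1 - q) M + (M - 1 - r)], this is the condition [r <= p] on the
remainder. *)
Definition level_ok (M s p : nat) : bool := (M <= p + (s %% M).+1)%N.

(** Modulo [M], the level [s] restricts the value to positions at least
M - 1 - s %% M.  Levels q M, ..., q M + u - 1 act on the positions from M - u on,
and there they turn the factors q + X one by one into q + 1 + X. *)
Lemma path_poly_level M q u a : (u <= M)%N -> (a <= M)%N ->
  path_poly (level_ok M) (q * M + u) a =
    (q%:R + 'X) ^+ minn a (M - u) * (q.+1%:R + 'X) ^+ (a - (M - u)).
Proof.
have main p v c : (v <= M)%N ->
    (forall d, (d <= M)%N ->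
      path_poly (level_ok M) (p * M) d = (p%:R + 'X) ^+ d) -> (c <= M)%N ->
    path_poly (level_ok M) (p * M + v) c =
      (p%:R + 'X) ^+ minn c (M - v) * (p.+1%:R + 'X) ^+ (c - (M - v)).
  move=> vM base; elim: v vM c => [_ c cM|v IHv vM c cM].
    by rewrite addn0 subn0 base // (minn_idPl cM) (eqP cM) mulr1.
  rewrite addnS; elim: c cM => [|c IHc] cM.
    by rewrite path_polyS0 IHv ?(ltnW vM) // !min0n !sub0n.
  rewrite path_polySS IHv ?(ltnW vM) // IHc ?(ltnW cM) //.
  rewrite /level_ok modnMDl modn_small //.
  case: leqP => Mc.
    have -> : minn c.+1 (M - v) = (M - v.+1).+1 by lia.
    have -> : minn c (M - v.+1) = (M - v.+1)%N by lia.
    have -> : minn c.+1 (M - v.+1) = (M - v.+1)%N by lia.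
    have -> : (c.+1 - (M - v) = c - (M - v.+1))%N by lia.
    have -> : (c.+1 - (M - v.+1) = (c - (M - v.+1)).+1)%N by lia.
    rewrite !exprS mul1r; move: (_ ^+ _) (_ ^+ _) => x y.
    by rewrite -natr1; ring.
  rewrite mulr0n mul0r addr0.
  by congr (_ ^+ _ * _ ^+ _); lia.
move=> uM aM; apply: (main) => // {u uM a aM}.
elim: q => [|q IHq] d dM; first by rewrite mul0n /= add0r.
by rewrite mulSnr main // subnn minn0 mul1r subn0.
Qed.

Lemma coef_path_poly_level M m a b : (a <= M)%N ->
  (path_poly (level_ok M) (m * M) a)`_b = m%:Z ^+ (a - b) * 'C(a, b)%:Z.
Proof.
move=> aM; rewrite -[(m * M)%N]addn0 path_poly_level // subn0.
rewrite (minn_idPl aM) (eqP aM) mulr1 exprDn coef_sum.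
have [ab|ba] := ltnP a b.
  rewrite bin_small // mulr0 big1 // => i _.
  rewrite coefMn -polyC_natr -polyC_exp coefCM coefXn gtn_eqF ?mulr0 ?mul0rn //.
  by apply: leq_ltn_trans ab; rewrite -ltnS.
rewrite (bigD1 (Ordinal (ba : (b < a.+1)%N))) //= big1 ?addr0 => [|i].
  by rewrite coefMn -polyC_natr -polyC_exp coefCM coefXn eqxx mulr1 -!natz mulr_natr.
rewrite -val_eqE eq_sym /= => /negPf ib.
by rewrite coefMn -polyC_natr -polyC_exp coefCM coefXn ib mulr0 mul0rn.
Qed.

(** In each term of the Leibniz expansion that does not vanish, the truncated
differences are genuine ones, and they sum up to the same exponent.  This
covers [x = 0] with [0 ^+ 0 = 1]. *)
Lemma det_homogeneous l (x : int) (a b : nat -> nat) (c : nat -> nat -> int) :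
  (forall i j : 'I_l, (a i < b j)%N -> c i j = 0) ->
  \det (\matrix_(i < l, j < l) (x ^+ (a i - b j) * c i j)) =
    x ^+ (\sum_(i < l) a i - \sum_(i < l) b i) *
      \det (\matrix_(i < l, j < l) c i j).
Proof.
move=> c0; rewrite /determinant mulr_sumr; apply: eq_bigr => s _.
rewrite mulrCA; congr (_ * _).
have [/existsP[i abi]|/existsPn ba] := boolP [exists i : 'I_l, (a i < b (s i))%N].
  by rewrite (bigD1 i) //= [X in _ = _ * X](bigD1 i) //= !mxE c0 // !(mulr0, mul0r).
under eq_bigr do rewrite mxE; under [in RHS]eq_bigr do rewrite mxE.
rewrite big_split /=; congr (_ * _).
rewrite -expr_sum; congr (_ ^+ _).
rewrite [X in (_ - X)%N](reindex_inj (@perm_inj _ s)) /=.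
by rewrite sumnB // => i _; rewrite leqNgt.
Qed.

(** * Ranking lecture hall entries *)

(** The rank of the pair of quotient and remainder of [x] by [p + 1] in the
reversed lexicographic order, remainders being counted in [0, M) at every
position so that ranks at different positions can be compared. *)
Definition level (m M p x : nat) : nat :=
  ((m.-1 - x %/ p.+1) * M + (M.-1 - x %% p.+1))%N.

Definition unlevel (m M p t : nat) : nat :=
  ((m.-1 - t %/ M) * p.+1 + (M.-1 - t %% M))%N.

Lemma level_divn m M p x : (p < M)%N ->
  (level m M p x %/ M)%N = (m.-1 - x %/ p.+1)%N.
Proof.
move=> pM; have lt : (M.-1 - x %% p.+1 < M)%N by lia.
by rewrite /level divnMDl ?(leq_ltn_trans _ pM) // (divn_small lt) addn0.
Qed.

Lemma level_modn m M p x : (p < M)%N ->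
  (level m M p x %% M)%N = (M.-1 - x %% p.+1)%N.
Proof. by move=> pM; rewrite /level modnMDl modn_small //; lia. Qed.

Lemma level_lt m M p x : (p < M)%N -> (x < m * p.+1)%N ->
  (level m M p x < m * M)%N.
Proof.
move=> pM; rewrite -ltn_divLR // => xm.
rewrite -ltn_divLR ?(leq_ltn_trans _ pM) // level_divn //.
by move: (x %/ _)%N xm => q; lia.
Qed.

Lemma level_ok_level m M p x : (p < M)%N -> level_ok M (level m M p x) p.
Proof.
by move=> pM; rewrite /level_ok level_modn //; have := @ltn_pmod x p.+1 isT; lia.
Qed.

Lemma levelK m M p x : (p < M)%N -> (x < m * p.+1)%N ->
  unlevel m M p (level m M p x) = x.
Proof.
move=> pM xm; rewrite /unlevel level_divn // level_modn //.
move: xm; rewrite -ltn_divLR // => xm.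
rewrite [RHS](divn_eq x p.+1); have := @ltn_pmod x p.+1 isT.
move: (x %/ p.+1)%N (x %% p.+1)%N xm => q r qm rp.
have -> : (m.-1 - (m.-1 - q) = q)%N by lia.
by have -> : (M.-1 - (M.-1 - r) = r)%N by lia.
Qed.

Lemma unlevel_lt m M p t : (p < M)%N -> (t < m * M)%N -> level_ok M t p ->
  (unlevel m M p t < m * p.+1)%N.
Proof.
move=> pM; rewrite -!ltn_divLR //; last by apply: leq_ltn_trans pM.
rewrite /level_ok /unlevel divnMDl // => tm ok.
have rp : (M.-1 - t %% M < p.+1)%N by lia.
by rewrite (divn_small rp) addn0; move: (t %/ M)%N tm => q; lia.
Qed.

Lemma unlevelK m M p t : (p < M)%N -> (t < m * M)%N -> level_ok M t p ->
  level m M p (unlevel m M p t) = t.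
Proof.
move=> pM tm ok; have M0 : (0 < M)%N by apply: leq_ltn_trans pM.
have tM : (t %% M < M)%N by rewrite ltn_pmod.
move: tm; rewrite -ltn_divLR // => tm.
have rp : (M.-1 - t %% M < p.+1)%N by move: ok; rewrite /level_ok; lia.
rewrite /level /unlevel divnMDl // modnMDl (divn_small rp) (modn_small rp).
rewrite [RHS](divn_eq t M) addn0.
move: (t %/ M)%N (t %% M)%N tm tM {ok rp} => q r qm rM.
have -> : (m.-1 - (m.-1 - q) = q)%N by lia.
by have -> : (M.-1 - (M.-1 - r) = r)%N by lia.
Qed.

(** The key comparison.  Both ratios have integer parts equal to their quotients;
when these agree, r' / (p + 2) <= r / (p + 1) amounts to r' <= r because r <= p.
Negating it, with the two positions exchanged, gives the comparison needed in
columns. *)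
Lemma level_le m M p x y : (p.+1 < M)%N ->
  (x < m * p.+1)%N -> (y < m * p.+2)%N ->
  (y * p.+1 <= x * p.+2)%N = (level m M p x <= level m M p.+1 y)%N.
Proof.
move=> pM; rewrite -!ltn_divLR // /level.
rewrite {2}(divn_eq x p.+1) {2}(divn_eq y p.+2).
have := @ltn_pmod x p.+1 isT; have := @ltn_pmod y p.+2 isT.
move: (x %/ _)%N (x %% _)%N (y %/ _)%N (y %% _)%N => q r q' r' r'p rp qm q'm.
case: (ltngtP q q') => [qq|qq|<-]; [apply/idP/idP; nia|apply/idP/idP; nia|].
by rewrite leq_add2l; apply/idP/idP; nia.
Qed.

Lemma divr_le_nat (x y d e : nat) :
  (x%:R / d.+1%:R <= y%:R / e.+1%:R :> rat) = (x * e.+1 <= y * d.+1)%N.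
Proof.
rewrite ler_pdivrMr ?ltr0Sn // mulrAC ler_pdivlMr ?ltr0Sn //.
by rewrite -!natrM ler_nat.
Qed.

(** * From lecture hall tableaux to fillings *)

Lemma finite_card_image (X : finType) (Y : choiceType) (A : {set X})
    (P : set Y) (f : X -> Y) : {in A &, injective f} ->
  (forall x, x \in A -> P (f x)) ->
  (forall y, P y -> exists2 x, x \in A & f x = y) ->
  finite_set P /\ #|` fset_set P| = #|A|.
Proof.
move=> fI fP fS.
have -> : P = [set` [fset f x | x in A]%fset]%classic.
  apply/seteqP; split=> y /=.
    by move=> /fS[x xA <-]; apply/imfsetP; exists x.
  by move=> /imfsetP[x /= xA ->]; apply: fP.
split; first exact: finite_fset.
by rewrite set_fsetK card_in_imfset //= -cardE.
Qed.

Lemma in_diagram la (c : nat * nat) :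
  (c \in diagram la) = [&& 0 < c.1, 0 < c.2 & c.2 <= part la c.1]%N.
Proof.
rewrite /diagram !inE; case: c => i j /=.
apply/allpairsPdep/and3P => [[i' [j' [+ + [-> ->]]]]|[i0 j0 ij]].
  by rewrite !mem_iota => /andP[i0 _] /andP[j0 jp]; split=> //; lia.
exists i, j; rewrite !mem_iota; split=> //; last by lia.
rewrite i0 add1n ltnS; case: (leqP i (size la)) => // il.
by move: ij; rewrite /part nth_default; lia.
Qed.

Lemma in_skew_shape la mu (c : nat * nat) :
  (c \in skew_shape la mu) = (0 < c.1)%N && (part mu c.1 < c.2 <= part la c.1)%N.
Proof.
by rewrite /skew_shape in_fsetD !in_diagram; lia.
Qed.

(** The end of row [i] in terms of positions; [i] is counted from 0 here. *)
Definition bead (n : nat) (la : seq nat) (i : nat) : nat :=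
  (part la i.+1 + n - i.+1)%N.

Lemma part_succ_le la i : is_partition la -> (part la i.+2 <= part la i.+1)%N.
Proof.
move=> /andP[/(sortedP 0%N) srt _]; rewrite /part /=.
have [ila|lai] := ltnP i.+1 (size la); first exact: srt.
by rewrite nth_default.
Qed.

Lemma part_le1 la i : is_partition la -> (part la i.+1 <= part la 1)%N.
Proof. by move=> hla; elim: i => // i; apply/leq_trans/part_succ_le. Qed.

Lemma bead_decreasing n la l : is_partition la -> (l <= n)%N ->
  decreasing_upto l (bead n la).
Proof.
by move=> hla ln i il; rewrite /bead; have := part_succ_le i hla; lia.
Qed.

Lemma part_le la mu i : (diagram mu `<=` diagram la)%fset -> (0 < i)%N ->
  (part mu i <= part la i)%N.
Proof.
move=> /fsubsetP sub i0; case: (posnP (part mu i)) => [->//|p0].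
have := sub (i, part mu i); rewrite !in_diagram /= i0 p0 leqnn /=.
by move=> /(_ isT).
Qed.

(** One less than the denominator n + c(i, j) of the lecture hall ratio. *)
Definition position (n : nat) (c : nat * nat) : nat := (n + c.2 - c.1.+1)%N.


Lemma position_right n i j : (i <= n)%N -> (0 < j)%N ->
  position n (i, j.+1) = (position n (i, j)).+1.
Proof. by rewrite /position /=; lia. Qed.

Lemma position_below n i j : (i < n)%N -> (0 < j)%N ->
  position n (i, j) = (position n (i.+1, j)).+1.
Proof. by rewrite /position /=; lia. Qed.

(** Replacing every entry by its level is a bijection: [level_le] translates the
row and column inequalities, and the bound on the floors becomes the bound
[m * M] on the levels. *)
Lemma card_LHT n m la mu : is_partition la -> (size la <= n)%N ->
  let l := size la in let M := (part la 1 + n)%N in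
  finite_set (LHT n m la mu) /\
  #|` fset_set (LHT n m la mu)| =
    #|tableaux l M (m * M) (level_ok M) (bead n la) (bead n mu)
       (fun=> (m * M)%N)|.
Proof.
move=> hla hlen l M; have ln : (l <= n)%N := hlen; set S := skew_shape la mu.
have rowP (c : S) : ((val c).1.-1 < l)%N.
  have := valP c; rewrite /= in_skew_shape => /andP[c0 /andP[mc cl]].
  rewrite ltnNge; apply/negP => lc; move: mc cl.
  by rewrite /part (nth_default _ lc); lia.
have cell_row (c : S) : (0 < (val c).1)%N.
  by have := valP c; rewrite /= in_skew_shape => /andP[].
have cell_col (c : S) : (0 < (val c).2)%N.
  have := valP c; rewrite /= in_skew_shape => /and3P[_ + _].
  exact: leq_ltn_trans.
have cell_n (c : S) : ((val c).1 <= n)%N.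
  apply: leq_trans hlen; have := rowP c; have := cell_row c.
  by case: (val c) => [[|i] j].
have posP (c : S) : (position n (val c) < M)%N.
  have := valP c; rewrite /= in_skew_shape => /andP[c0 /andP[mc cl]].
  by have := part_le1 (fsval c).1.-1 hla; rewrite /position /M /= prednK //; lia.
pose box (c : S) : 'I_l * 'I_M := (Ordinal (rowP c), Ordinal (posP c)).
(* Undoing [box]: rows of the shape are numbered from 1. *)
pose cell (d : 'I_l * 'I_M) := (d.1.+1, d.2 + d.1.+2 - n)%N.
have cellP (d : 'I_l * 'I_M) :
    (cell d \in S) = skew_cell (bead n la) (bead n mu) d.1 d.2.
  rewrite in_skew_shape /skew_cell /bead /=; have := ltn_ord d.1; lia.
have boxK (c : S) : cell (box c) = val c.
  have := valP c; rewrite /= in_skew_shape /cell /= /position.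
  have := rowP c; rewrite /=; case: (fsval c) => i j /= il /andP[i0 /andP[mc cl]].
  by congr pair; lia.
have cellK (c : S) d : val c = cell d -> box c = d.
  move=> cd; have := valP c; rewrite /= cd in_skew_shape /= => dS.
  apply: cell_inj; rewrite /= /position cd //=; have := ltn_ord d.1; lia.
have box_skew (c : S) :
    skew_cell (bead n la) (bead n mu) (box c).1 (box c).2.
  by rewrite -cellP boxK; apply: valP.
have lhE (L : tableau S) (c : S) :
    lh_ratio n L c = (L c)%:R / (position n (val c)).+1%:R.
  have := valP c; rewrite /= in_skew_shape => /andP[c0 /andP[mc cl]].
  rewrite /lh_ratio /content; congr (_ / _); rewrite -[RHS]/((_.+1)%:Z%:~R).
  by congr (_%:~R); have := rowP c; rewrite /position /=; lia.
have floorE (L : tableau S) (c : S) : (Num.floor (lh_ratio n L c) < m%:Z) =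
    (L c < m * (position n (val c)).+1)%N.
  by rewrite floor_lt_int lhE ltr_pdivrMr ?ltr0Sn // -natrM ltr_nat.
have adjE (L : tableau S) (c d : S) :
    (L c < m * (position n (val c)).+1)%N ->
    (L d < m * (position n (val d)).+1)%N ->
    position n (val d) = (position n (val c)).+1 ->
    (lh_ratio n L d <= lh_ratio n L c) =
    (level m M (position n (val c)) (L c) <=
     level m M (position n (val d)) (L d))%N.
  move=> cm dm dc; rewrite !lhE divr_le_nat dc; apply: level_le => //.
    by rewrite -dc posP.
  by rewrite -dc.
pose dec (T : {ffun 'I_l * 'I_M -> 'I_(m * M).+1}) : tableau S :=
  [ffun c => unlevel m M (position n (val c)) (T (box c))].
apply: (@finite_card_image _ _ _ _ dec).
- move=> T U /tableauxP[v v0 _ _] /tableauxP[w w0 _ _] TU; apply/ffunP => d.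
  case: (boolP (skew_cell (bead n la) (bead n mu) d.1 d.2)) => ds; last first.
    by rewrite v0 ?w0.
  have dS : cell d \in S by rewrite cellP.
  have bd : box [` dS]%fset = d by apply: cellK.
  have [vt vo] := v d ds; have [wt wo] := w d ds.
  have pd : position n (cell d) = d.2 by rewrite -[in RHS]bd.
  have := congr1 (level m M d.2) (congr1 (fun f : tableau S => f [` dS]%fset) TU).
  rewrite !ffunE /= bd pd !unlevelK // => e.
  exact: val_inj.
- move=> T /tableauxP[v _ row col].
  have bnd c : (dec T c < m * (position n (val c)).+1)%N.
    by have [? ?] := v _ (box_skew c); rewrite ffunE unlevel_lt.
  have levE c : level m M (position n (val c)) (dec T c) = T (box c).
    by have [? ?] := v _ (box_skew c); rewrite ffunE unlevelK.
  split; last by move=> c; rewrite floorE bnd.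
  split=> c d cd.
    have e : position n (val d) = (position n (val c)).+1.
      by rewrite cd position_right ?cell_n ?cell_col.
    by rewrite adjE // !levE; apply: row => //; rewrite /= cd.
  have e : position n (val c) = (position n (val d)).+1.
    have := cell_n d; rewrite cd => dn.
    by rewrite -position_below ?cell_col.
  rewrite ltNge adjE // !levE -ltnNge; apply: col => //.
  change ((val d).1.-1 = (val c).1.-1.+1); rewrite cd /=.
  exact/esym/prednK/cell_row.
move=> L [[row col] bnd0].
have bnd c : (L c < m * (position n (val c)).+1)%N by rewrite -floorE.
pose lev c := level m M (position n (val c)) (L c).
pose T : {ffun 'I_l * 'I_M -> 'I_(m * M).+1} :=
  [ffun d => if insub (cell d) is Some c then inord (lev c) else ord0].
have TE (c : S) : T (box c) = lev c :> nat.
  rewrite ffunE boxK valK inordK // ltnS ltnW //.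
  by apply: level_lt.
have boxP (d : 'I_l * 'I_M) : skew_cell (bead n la) (bead n mu) d.1 d.2 ->
    exists2 c : S, d = box c & val c = cell d.
  by rewrite -cellP => dS; exists [` dS]%fset => //; rewrite (cellK _ d).
exists T; last first.
  by apply/ffunP => c; rewrite ffunE TE levelK.
apply/tableauxP; split.
- move=> d /boxP[c -> _]; rewrite TE; split; first exact: level_lt.
  exact: level_ok_level.
- by move=> d; rewrite -cellP => dS; rewrite ffunE insubN.
- move=> d e /boxP[c dc vc] /boxP[c' ec vc'] e1 e2.
  have pos : position n (val c') = (position n (val c)).+1.
    by move: e2; rewrite dc ec.
  rewrite dc ec !TE /lev -adjE //; apply: row; have := cell_col c.
  by rewrite vc vc' /cell /= e1 e2 => p0; congr pair; lia.
- move=> d e /boxP[c dc vc] /boxP[c' ec vc'] e1 e2.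
  have pos : position n (val c) = (position n (val c')).+1.
    by move: e2; rewrite dc ec.
  rewrite dc ec !TE /lev ltnNge -adjE // -ltNge; apply: col.
  by rewrite vc vc' /cell /= e1 e2; congr pair; lia.
Qed.

(** * The lecture hall count *)

Lemma card_skew_shape n la mu :
  (diagram mu `<=` diagram la)%fset -> (size la <= n)%N ->
  #|` skew_shape la mu| =
    (\sum_(i < size la) bead n la i - \sum_(i < size la) bead n mu i)%N.
Proof.
move=> sub hlen.
pose s := [seq (i.+1, j) | i <- iota 0 (size la),
  j <- iota (part mu i.+1).+1 (part la i.+1 - part mu i.+1)].
have -> : skew_shape la mu = [fset c in s]%fset.
  apply/fsetP => [[i j]]; rewrite in_skew_shape inE /=.
  apply/andP/allpairsPdep => [[i0 /andP[mj jl]]|[i' [j' [+ + [-> ->]]]]].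
    exists i.-1, j; rewrite prednK // !mem_iota; split=> //; last by lia.
    rewrite /= add0n ltnNge; apply/negP => li; move: mj jl.
    by rewrite /part (nth_default _ li); lia.
  rewrite !mem_iota => _; have := part_le sub (ltn0Sn i'); split=> //; lia.
rewrite card_fseq undup_id; last first.
  apply: allpairs_uniq_dep => [|i _|]; [exact: iota_uniq|exact: iota_uniq|].
  by move=> [i j] [i' j'] _ _ /= [-> ->].
rewrite size_allpairs_dep sumnE big_map -sumnB; last first.
  by move=> i _; have := part_le sub (ltn0Sn i); rewrite /bead; lia.
rewrite -(big_mkord xpredT (fun i => bead n la i - bead n mu i)%N).
rewrite /index_iota subn0; apply: eq_big_seq => i; rewrite mem_iota => /andP[_].
by rewrite size_iota /bead; lia.
Qed.

Theorem theorem1p1 (n m : nat) (la mu : seq nat)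
    (hla : is_partition la) (hmu : is_partition mu)
    (hsub : (diagram mu `<=` diagram la)%fset)
    (hlen : (size la <= n)%N) :
  finite_set (LHT n m la mu) /\
  #|` fset_set (LHT n m la mu)|%:Z =
    m%:Z ^+ #|` skew_shape la mu| *
    \det (\matrix_(i < size la, j < size la)
            ('C(part la i.+1 + n - i.+1, part mu j.+1 + n - j.+1))%:Z).
Proof.
have [fin ->] := card_LHT m mu hla hlen; split=> //.
have bead_le i : (i < size la)%N ->
    (bead n mu i <= bead n la i <= part la 1 + n)%N.
  move=> il; have := part_le hsub (ltn0Sn i); have := part_le1 i hla.
  by rewrite /bead; lia.
rewrite card_tableaux //; [|exact: bead_decreasing..].
rewrite (card_skew_shape hsub hlen).
pose c i j := 'C(bead n la i, bead n mu j)%:Z.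
rewrite -(@det_homogeneous _ _ _ _ c) => [|i j /bin_small]; last by rewrite /c => ->.
congr (\det _); apply/matrixP => i j; rewrite !mxE.
by rewrite coef_path_poly_level //; have /andP[] := bead_le i (ltn_ord i).
Qed.
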